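(* Let $G$ be a non-trivial linearly ordered group and let $A$ be a non-empty shift-set in $G$. Then for arbitrary elements $(a,b),(c,d)\in\mathscr{B}(A)$ the following conditions are equivalent: (i) $(a,b)\preccurlyeq(c,d)$ in $\mathscr{B}(A)$; (ii) $a^{-1}\cdot b=c^{-1}\cdot d$ and $a\geqslant c$ in $A$; (iii) $b^{-1}\cdot a=d^{-1}\cdot c$ and $b\geqslant d$ in $A$.
   Context: A linearly ordered group is a group $(G,\cdot)$ with a total order $\leqslant$ such that $a\leqslant b$ implies $a\cdot g\leqslant b\cdot g$ and $g\cdot a\leqslant g\cdot b$ for all $a,b,g\in G$. A subset $A\subseteq G$ is a shift-set if for any $x,y,z\in A$ with $y<x$ one has $x\cdot y^{-1}\cdot z\in A$. For a non-empty shift-set $A$, $\mathscr{B}(A)$ is the semigroup with underlying set $A\times A$ and the (associative) operation $$(a,b)(c,d)=\begin{cases}(c\cdot b^{-1}\cdot a,\,d), & b<c;\\ (a,d), & b=c;\\ (a,\,b\cdot c^{-1}\cdot d), & b>c.\end{cases}$$ $\mathscr{B}(A)$ is an inverse semigroup; the inverse of $(a,b)$ is $(b,a)$, and its idempotents are the pairs $(a,a)$, $a\in A$. On an inverse semigroup $S$ the natural partial order is defined by $s\preccurlyeq t$ iff $s=\varepsilon t$ for some idempotent $\varepsilon\in S$. *)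

(* Defs.v *)
From HB Require Import structures.
From mathcomp Require Import all_boot all_order monoid.
From mathcomp Require Import boolp classical_sets.

Set Implicit Arguments.
Unset Strict Implicit.
Unset Printing Implicit Defensive.

Import Order.TTheory.
Local Open Scope classical_set_scope.
Local Open Scope group_scope.
Local Open Scope order_scope.

HB.mixin Record isLinearlyOrderedGroup (disp : Order.disp_t) G
    of Group G & Order.Total disp G := {
  lemulg2r : forall g a b : G, a <= b -> a * g <= b * g;
  lemulg2l : forall g a b : G, a <= b -> g * a <= g * b
}.

#[short(type="linearlyOrderedGroupType")]
HB.structure Definition LinearlyOrderedGroup (disp : Order.disp_t) :=
  { G of Group G & Order.Total disp G & isLinearlyOrderedGroup disp G }.

Definition idempotent_elt (S : semigroupType) (e : S) : Prop := e * e = e.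

Definition inverse_of (S : semigroupType) (s t : S) : Prop :=
  s * t * s = s /\ t * s * t = t.

HB.mixin Record isInverseSemigroup S of Semigroup S := {
  inverse_exists_unique : forall s : S, exists! t : S, inverse_of s t
}.

#[short(type="inverseSemigroupType")]
HB.structure Definition InverseSemigroup :=
  { S of Semigroup S & isInverseSemigroup S }.

Definition natural_le (S : inverseSemigroupType) (s t : S) : Prop :=
  exists2 e : S, idempotent_elt e & s = e * t.

Definition shift_set (disp : Order.disp_t)
    (G : linearlyOrderedGroupType disp) (A : set G) : Prop :=
  forall x y z : G, A x -> A y -> A z -> y < x -> A (x * y^-1 * z).

Section ShiftSemigroup.
Variables (disp : Order.disp_t) (G : linearlyOrderedGroupType disp).
Variables (A : set G) (shA : shift_set A).

Lemma shift_subproof (x y z : A) :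
  val y < val x -> val x * (val y)^-1 * val z \in A.
Proof.
by move=> yx; apply/mem_set/shA => //; apply/set_mem; apply: valP.
Qed.

Definition shift (x y z : A) (yx : val y < val x) : A :=
  Sub (val x * (val y)^-1 * val z) (shift_subproof z yx).

(* The phantom argument [shA] makes the operation, which needs [A] to be a
   shift-set, available as a canonical instance. *)
Definition shift_semigroup of shift_set A : Type := (A * A)%type.

Local Notation BA := (shift_semigroup shA).

HB.instance Definition _ := Choice.copy BA (A * A)%type.

Definition shift_mul (s t : BA) : BA :=
  let: (a, b) := s in
  let: (c, d) := t in
  match @idP (val b < val c), @idP (val c < val b) with
  | ReflectT bc, _ => (shift a bc, d)
  | _, ReflectT cb => (a, shift d cb)
  | _, _ => (a, d)
  end.

Definition shift_val (s : BA) : G * G := (val s.1, val s.2).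

Lemma shift_val_inj : injective shift_val.
Proof. by move=> [a b] [c d] [/val_inj-> /val_inj->]. Qed.

Lemma shift_val_mul (s t : BA) : shift_val (shift_mul s t) =
  let m := Order.max (val s.2) (val t.1) in
  (m * (val s.2)^-1 * val s.1, m * (val t.1)^-1 * val t.2).
Proof.
case: s t => [a b] [c d]; rewrite /shift_mul /shift_val /=.
case: {-}_ / idP => [bc|/negP nbc].
  by rewrite (max_r (ltW bc)) /= mulgV mul1g.
case: {-}_ / idP => [cb|/negP ncb].
  by rewrite (max_l (ltW cb)) /= mulgV mul1g.
have -> : val b = val c by apply: le_anti; rewrite !leNgt nbc ncb.
by rewrite maxxx mulgV !mul1g.
Qed.

Lemma max_mulg (x y g : G) : Order.max x y * g = Order.max (x * g) (y * g).
Proof.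
case: (leP x y) => [xy|/ltW yx].
  by rewrite (max_r (lemulg2r g _ _ xy)).
by rewrite (max_l (lemulg2r g _ _ yx)).
Qed.

Lemma shift_mulA : associative shift_mul.
Proof.
move=> s t u; apply: shift_val_inj; rewrite !shift_val_mul /=.
case: s t u => [a b] [c d] [e f] /=.
have /= [-> ->] := shift_val_mul (a, b) (c, d).
have /= [-> ->] := shift_val_mul (c, d) (e, f).
move: (val a) (val b) (val c) (val d) (val e) (val f) => {}a {}b {}c {}d {}e {}f.
set m := Order.max b c; set k := Order.max d e.
set p := Order.max b _; set n := Order.max _ e.
have kE : k * d^-1 * c = Order.max c (e * d^-1 * c).
  by rewrite /k !max_mulg mulgV mul1g.
have nE : n * d^-1 * c = Order.max m (e * d^-1 * c).
  by rewrite /n 2!max_mulg mulgK mulgVK.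
have pE : p = n * d^-1 * c by rewrite nE /p kE /m maxA.
by rewrite pE !invgM !invgK !mulgA !(mulgK, mulgVK).
Qed.

HB.instance Definition _ := hasMul.Build BA shift_mul.
HB.instance Definition _ := Magma_isSemigroup.Build BA shift_mulA.

Lemma shift_inverse_bounds (a b c d : A) :
  ((a, b) : BA) * (c, d) * (a, b) = (a, b) ->
  val d = val c * (val b)^-1 * val a /\ val c <= val b.
Proof.
move=> /(congr1 shift_val); rewrite [LHS]shift_val_mul /=.
have /= [-> ->] := shift_val_mul (a, b) (c, d).
rewrite /shift_val /=.
move: (val a) (val b) (val c) (val d) => {}a {}b {}c {}d.
set m := Order.max b c; set n := Order.max _ a.
case=> eqa eqb.
have na : n = a.
  by apply: (mulIg a^-1); apply: (mulIg b); rewrite eqb mulgV mul1g.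
have dE : d = c * b^-1 * a.
  move: eqa; rewrite na !invgM invgK !mulgA mulgVK => eqa.
  by apply: (mulgI (a * d^-1)); rewrite mulgVK !mulgA eqa.
split=> //; have : m * c^-1 * d <= a by rewrite -na /n le_max lexx.
rewrite dE !mulgA mulgVK => /(lemulg2r (a^-1 * b)).
rewrite !mulgA !(mulgK, mulgVK) mulgV mul1g.
by apply: le_trans; rewrite /m le_max lexx orbT.
Qed.

Lemma shift_inverseP (a b c d : A) :
  inverse_of ((a, b) : BA) (c, d) <-> c = b /\ d = a.
Proof.
split=> [[/shift_inverse_bounds[dE cb] /shift_inverse_bounds[_ ad]]|[-> ->]].
  have da : val d = val a.
    apply/le_anti; rewrite ad andbT dE.
    have := lemulg2r ((val b)^-1 * val a) _ _ cb.
    by rewrite !mulgA mulgV mul1g.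
  split; apply: val_inj => //.
  apply: (mulIg ((val b)^-1 * val a)).
  by rewrite !mulgA -dE mulgV mul1g.
have mulE (x y z : A) : ((x, y) : BA) * (y, z) = (x, z).
  by apply: shift_val_inj; rewrite shift_val_mul /= maxxx mulgV !mul1g.
by split; rewrite !mulE.
Qed.

Lemma shift_inverse_exists_unique (s : BA) : exists! t : BA, inverse_of s t.
Proof.
case: s => [a b]; exists (b, a); split; first exact/shift_inverseP.
by move=> [c d] /shift_inverseP[-> ->].
Qed.

HB.instance Definition _ :=
  isInverseSemigroup.Build BA shift_inverse_exists_unique.

Lemma shift_idempotentP (a b : A) : idempotent_elt ((a, b) : BA) <-> a = b.
Proof.
split=> [ee|->].
  have /shift_inverseP[] // : inverse_of ((a, b) : BA) (a, b).
  by split; rewrite !ee.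
by apply: shift_val_inj; rewrite [LHS]shift_val_mul /= maxxx mulgV !mul1g.
Qed.

End ShiftSemigroup.

(* Main.v *)
Require Import Defs.
From mathcomp Require Import all_boot all_order monoid.
From mathcomp Require Import boolp classical_sets.

(** Multiplying [(c, d)] on the left by an idempotent [(e, e)] yields
    [(m, m * c^-1 * d)] with [m] the larger of [e] and [c]
    ([shift_val_idem_mul]): the first coordinate goes up to [m] while the
    quotient [c^-1 * d] is preserved.  Hence every element below [(c, d)] has
    the same quotient and a first coordinate at least [c]; conversely, if
    [a^-1 * b = c^-1 * d] and [c <= a], then [e := a] gives [m = a] and the
    product is [(a, b)].
    Inverting the equality of quotients swaps the roles of the two
    coordinates, and since one left translation carries both [c] to [a] and
    [d] to [b], comparing [a] with [c] amounts to comparing [b] with [d]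
    ([quotient_le]). *)

Import Order.TTheory.
Local Open Scope classical_set_scope.
Local Open Scope group_scope.
Local Open Scope order_scope.

Lemma shift_val_idem_mul (disp : Order.disp_t)
    (G : linearlyOrderedGroupType disp) (A : set G) (shA : shift_set A)
    (e c d : A) :
  shift_val (((e, e) : shift_semigroup shA) * (c, d)) =
  (Order.max (val e) (val c),
   Order.max (val e) (val c) * (val c)^-1 * val d).
Proof. by rewrite shift_val_mul /= mulgVK. Qed.

Lemma quotientE (G : groupType) (a b c d : G) :
  a^-1 * b = c^-1 * d -> b = a * c^-1 * d.
Proof. by move=> q; rewrite -mulgA -q mulgA mulgV mul1g. Qed.

Lemma quotient_sym (G : groupType) (a b c d : G) :
  a^-1 * b = c^-1 * d -> b^-1 * a = d^-1 * c.
Proof. by move=> /(congr1 inv); rewrite !invgM !invgK. Qed.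

(** Equal left quotients mean that [b] arises from [d] by the same left
    translation, by [a * c^-1], that sends [c] to [a]; if it moves [c] up,
    then, the order being translation-invariant, it moves [d] up too. *)
Lemma quotient_le (disp : Order.disp_t) (G : linearlyOrderedGroupType disp)
    (a b c d : G) :
  a^-1 * b = c^-1 * d -> c <= a -> d <= b.
Proof.
move=> /quotientE -> /(lemulg2r (c^-1 * d)).
by rewrite !mulgA mulgV mul1g.
Qed.

Theorem lemma2p2 (disp : Order.disp_t) (G : linearlyOrderedGroupType disp)
    (ntG : exists g : G, g <> 1) (A : set G) (A_neq0 : A !=set0)
    (shA : shift_set A) (a b c d : A) :
  [<-> natural_le ((a, b) : shift_semigroup shA) (c, d);
       (val a)^-1 * val b = (val c)^-1 * val d /\ val a >= val c;
       (val b)^-1 * val a = (val d)^-1 * val c /\ val b >= val d].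
Proof.
tfae.
- move=> [[e e'] /shift_idempotentP <- /(congr1 (@shift_val _ _ _ shA))].
  rewrite shift_val_idem_mul /shift_val /= => -[aE bE].
  by rewrite bE aE !mulgA mulVg mul1g le_max lexx orbT.
- by move=> [q ca]; split; [apply: quotient_sym | apply: quotient_le ca].
- move=> [q db]; exists (a, a); first exact/shift_idempotentP.
  apply: (@shift_val_inj _ _ _ shA).
  rewrite shift_val_idem_mul (max_l (quotient_le _ _ _ _ _ _ q db)).
  by rewrite -(quotientE _ _ _ _ _ (quotient_sym _ _ _ _ _ q)).
Qed.
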